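(* Let $k\in\mathbb{K}_N$ and let the parameters $m,\tau,k^*,R,\lambda_{j,1},\lambda_{j,2}$ be chosen as described in the context. Then for every $j=1,\dots,m$ (and at every point $x\in\partial B_j$) $$|\det(A_{j,k})|\ \ge\ \begin{cases}\dfrac{M}{kR}, & k\in\mathbb{K}_N\setminus\{k^*\},\\[2mm] M^*, & k=k^*,\end{cases}$$ and $$|\det(D_{j,k})|\ \ge\ \begin{cases}\left(\dfrac{M}{kR}\right)^3, & k\in\mathbb{K}_N\setminus\{k^*\},\\[2mm] (M^* )^3, & k=k^*,\end{cases}$$ where $M=\dfrac{20\tau-7}{20\tau}$ and $M^*=\dfrac49$.
   Context: Let $a>0$. $J_0$ and $Y_0$ are the Bessel functions of the first and second kind of order zero. Parameters: $m\ge 10$ is an integer, $\tau\ge 6$ is real, $k^*=\frac{\pi}{30a}$, and $\lambda_{j,1}=\frac12$ for all $j$. The admissible set of wavenumbers is $\mathbb{K}_N=\{\frac{\pi}{a}t: t\in\mathbb{R},\,t\ge 1\}\cup\{k^*\}$. If $k\in\mathbb{K}_N\setminus\{k^*\}$, then $R=\tau a$ and $\lambda_{j,2}=\frac12+\frac{\pi}{2kR}$; if $k=k^*$, then $R=6a$ and $\lambda_{j,2}=-\frac32$. Geometry: $\nu_s=s\pi/m$ for $s\in\mathbb{R}$. For $j=1,\dots,m$, $\partial B_j=\{R(\cos\theta,\sin\theta):\nu_{2j-2}\le\theta\le\nu_{2j}\}$, and $z_{j,\ell}=\lambda_{j,\ell}R(\cos\nu_{2j-1},\sin\nu_{2j-1})$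 for $\ell=1,2$. For $x\in\partial B_j$ put $r_{j,\ell}=r_{j,\ell}(x)=|x-z_{j,\ell}|$. Matrix functions of $x\in\partial B_j$: $$A_{j,k}=\begin{pmatrix} Y_0(kr_{j,1}) & -J_0(kr_{j,1}) \\ Y_0(kr_{j,2}) & -J_0(kr_{j,2}) \end{pmatrix},$$ $$D_{j,k}=\begin{pmatrix} Y_0^2(kr_{j,1}) & J_0^2(kr_{j,1}) & -2Y_0(kr_{j,1})J_0(kr_{j,1}) \\ Y_0^2(kr_{j,2}) & J_0^2(kr_{j,2}) & -2Y_0(kr_{j,2})J_0(kr_{j,2}) \\ Y_0(kr_{j,1})Y_0(kr_{j,2}) & J_0(kr_{j,1})J_0(kr_{j,2}) & -Y_0(kr_{j,1})J_0(kr_{j,2})-Y_0(kr_{j,2})J_0(kr_{j,1}) \end{pmatrix}.$$ *)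

(* Defs.v *)
From Stdlib Require Export Reals Factorial.
From Coquelicot Require Export Coquelicot.
From mathcomp Require Export all_boot all_order all_algebra.
From mathcomp Require Export Rstruct.

(* Matrices and determinants are MathComp's over Stdlib's R (through Rstruct);
   the arithmetic on R is Stdlib's, hence the order in which scopes are opened. *)
Global Open Scope ring_scope.
Global Open Scope R_scope.

Definition harmonic (n : nat) : R := sum_n_m (fun i => / INR i) 1 n.

Definition euler_gamma : R :=
  real (Lim_seq (fun n => harmonic n - ln (INR n))).

Definition J0 (x : R) : R :=
  PSeries (fun n => (-1) ^ n / (INR (fact n)) ^ 2) ((x / 2) ^ 2).

(* Standard expansion of the Bessel function of the second kind (DLMF 10.8.2);
   meaningful for x > 0. *)
Definition Y0 (x : R) : R :=
  2 / PI * ((ln (x / 2) + euler_gamma) * J0 x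
            - PSeries (fun n => (-1) ^ n * harmonic n / (INR (fact n)) ^ 2)
                ((x / 2) ^ 2)).

Definition kstar (a : R) : R := PI / (30 * a).

Definition admissible (a k : R) : Prop :=
  (exists t : R, 1 <= t /\ k = PI / a * t) \/ k = kstar a.

Definition radius (a tau k : R) : R :=
  if Req_dec_T k (kstar a) then 6 * a else tau * a.

Definition lambda1 : R := 1 / 2.

Definition lambda2 (a tau k : R) : R :=
  if Req_dec_T k (kstar a) then - (3 / 2)
  else 1 / 2 + PI / (2 * k * radius a tau k).

Definition nu (m : nat) (s : R) : R := s * PI / INR m.

Definition polar (rho theta : R) : R * R := (rho * cos theta, rho * sin theta).

Definition arc (m : nat) (rho : R) (j : nat) (x : R * R) : Prop :=
  exists theta : R,
    nu m (2 * INR j - 2) <= theta <= nu m (2 * INR j) /\ x = polar rho theta.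

Definition source (m : nat) (rho lambda : R) (j : nat) : R * R :=
  polar (lambda * rho) (nu m (2 * INR j - 1)).

Definition dist2 (x y : R * R) : R := dist_euc x.1 x.2 y.1 y.2.

Definition mx_of_rows (n : nat) (rows : seq (seq R)) : 'M[R]_n :=
  \matrix_(i < n, j < n) nth 0 (nth [::] rows i) j.

Definition matA (k r1 r2 : R) : 'M[R]_2 :=
  mx_of_rows 2
    [:: [:: Y0 (k * r1); - J0 (k * r1)];
        [:: Y0 (k * r2); - J0 (k * r2)]].

Definition matD (k r1 r2 : R) : 'M[R]_3 :=
  mx_of_rows 3
    [:: [:: Y0 (k * r1) ^ 2; J0 (k * r1) ^ 2; - (2 * Y0 (k * r1) * J0 (k * r1))];
        [:: Y0 (k * r2) ^ 2; J0 (k * r2) ^ 2; - (2 * Y0 (k * r2) * J0 (k * r2))];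
        [:: Y0 (k * r1) * Y0 (k * r2); J0 (k * r1) * J0 (k * r2);
            - (Y0 (k * r1) * J0 (k * r2)) - Y0 (k * r2) * J0 (k * r1)]].

Definition A_at (a tau : R) (m : nat) (k : R) (j : nat) (x : R * R) : 'M[R]_2 :=
  let rho := radius a tau k in
  matA k (dist2 x (source m rho lambda1 j))
         (dist2 x (source m rho (lambda2 a tau k) j)).

Definition D_at (a tau : R) (m : nat) (k : R) (j : nat) (x : R * R) : 'M[R]_3 :=
  let rho := radius a tau k in
  matD k (dist2 x (source m rho lambda1 j))
         (dist2 x (source m rho (lambda2 a tau k) j)).

Definition M (tau : R) : R := (20 * tau - 7) / (20 * tau).

Definition Mstar : R := 4 / 9.

(* Main.v *)
Require Import Defs.
From Stdlib Require Import Lra Lia.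

(** Write [cross x y] for [J0 x * Y0 y - J0 y * Y0 x].  The first determinant is
    [cross (k r1) (k r2)].  The second matrix is the symmetric square of the
    first one, so its determinant is the cube of the first determinant, and
    only [cross] has to be bounded from below.

    As a function of one argument, [cross] solves the Bessel equation and
    vanishes at the other argument.  Its slope there is given by the Wronskian
    [s (J0 Y0' - Y0 J0') = 2 / PI] ([bessel_wronskian]), which is read off the
    defining power series.  No asymptotic expansion of [J0] or [Y0] is needed:
    in both regimes the arguments are close enough for the initial value
    problem alone to control [cross].

    In the regime [k = PI t / a] with [t >= 1], both arguments exceed [7.5] and
    differ by about [PI / 2].  After the Liouville substitution [u = sqrt s * F]
    the equation reads [u'' + (1 + 1 / (4 s^2)) u = 0], a small perturbation
    of the harmonic oscillator, so that [sqrt (x y) |cross x y|] is almost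
    [(2 / PI) sin (x - y)] ([cross_lower_far]).  The geometry keeps [x - y]
    between [0.74 * PI / 2] and [PI / 2] and [x] below [0.548 k R]; this gives
    [|cross| >= 1 / (k R)] ([cross_far_sources]), and [M tau < 1].

    In the regime [k = kstar], both arguments lie in [(0, 2)], where [J0] is
    positive.  There [(Y0 / J0)' = (2 / PI) / (s J0^2)], and the elementary
    estimate [J0^2 <= 1 / (1 + s^2 / 2)] integrates to
    [cross x y >= (2 / PI) J0 x J0 y (ln (y / x) + (y^2 - x^2) / 4)]
    ([cross_lower_near]).  Here [k R = PI / 5], and inserting
    [J0 >= 1 - s^2 / 4] gives [4 / 9] ([cross_near_sources]). *)

Set Implicit Arguments.

(** * Elementary analysis *)

(** Partial sums of the arctangent series in
    [PI / 4 = 2 atan (1/3) + atan (1/7)]. *)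
Lemma pi_bounds : 31 / 10 <= PI <= 315 / 100.
Proof.
have [lo _] := PI_2_3_7_ineq 0.
have [_ up] := PI_2_3_7_ineq 1.
move: lo up; rewrite /= /tg_alt /PI_2_3_7_tg /Ratan_seq /=.
lra.
Qed.

Lemma cos_ge_quadratic (t : R) : -2 <= t <= 2 -> 1 - t ^ 2 / 2 <= cos t.
Proof.
move=> [t1 t2]; have [H _] := pre_cos_bound t 0 t1 t2.
by move: H; rewrite /cos_approx /cos_term /=; lra.
Qed.

Lemma nondecreasing_of_derive (f df : R -> R) (a b : R) : a <= b ->
  (forall c, a <= c <= b -> is_derive f c (df c)) ->
  (forall c, a < c < b -> 0 <= df c) -> f a <= f b.
Proof.
move=> ab Hf Hdf; case: (Rle_lt_or_eq_dec _ _ ab) => [lt_ab|->]; last lra.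
have [c [E cab]] := MVT_cor2 f df a b lt_ab
  (fun c h => proj1 (is_derive_Reals _ _ _) (Hf c h)).
have := Rmult_le_pos _ _ (Hdf c cab) (Rlt_le _ _ (Rlt_Rminus _ _ lt_ab)).
lra.
Qed.

(** The form in which the derivative of an unspecified function is needed to
    discharge and simplify what [auto_derive] produces. *)
Lemma is_derive_ex_eq (f : R -> R) (s l : R) :
  is_derive f s l -> ex_derive (fun z => f z) s /\ Derive (fun z => f z) s = l.
Proof. by move=> Hf; split; [exists l | apply: is_derive_unique]. Qed.

(** * The power series behind J0 and Y0 *)

Definition J_coef (n : nat) : R := (-1) ^ n / INR (fact n) ^ 2.

Definition Y_coef (n : nat) : R := (-1) ^ n * harmonic n / INR (fact n) ^ 2.

(** Both series are taken in the variable [t = (s / 2)^2].  There the Bessel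
    equation becomes [(t f')' = - f], and [J_ser], [Y_ser] and their fluxes are
    entire, so that identities between them can be checked at [t = 0]. *)
Definition J_ser : R -> R := PSeries J_coef.

Definition dJ_ser : R -> R := PSeries (PS_derive J_coef).

Definition Y_ser : R -> R := PSeries Y_coef.

Definition dY_ser : R -> R := PSeries (PS_derive Y_coef).

Definition J_flux (t : R) : R := t * dJ_ser t.

Definition Y_flux (t : R) : R := t * dY_ser t.

Lemma fact_ge1 (n : nat) : 1 <= INR (fact n).
Proof. by apply: (le_INR 1); have := lt_O_fact n; lia. Qed.

Lemma INR_factS (n : nat) : INR (fact n.+1) = (INR n + 1) * INR (fact n).
Proof. by rewrite fact_simpl mult_INR S_INR. Qed.

Lemma harmonicS (n : nat) : harmonic n.+1 = harmonic n + / INR n.+1.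
Proof.
rewrite /harmonic; case: n => [|n].
  by rewrite sum_n_n sum_n_m_zero /zero /=; [ring|lia].
by rewrite sum_n_Sm; [|lia].
Qed.

Lemma harmonic_bounds (n : nat) : 0 <= harmonic n <= INR (fact n).
Proof.
suff : 0 <= harmonic n <= INR n.
  have : INR n <= INR (fact n); last lra.
  apply: le_INR; elim: n => [|n IH] /=; first lia.
  have := lt_O_fact n; nia.
elim: n => [|n IH]; first by rewrite /harmonic sum_n_m_zero /zero /=; [lra|lia].
rewrite harmonicS.
have n1 : 1 <= INR n.+1 by rewrite S_INR; have := pos_INR n; lra.
have : 0 < / INR n.+1 by apply: Rinv_0_lt_compat; lra.
have := Rinv_le_contravar 1 _ ltac:(lra) n1.
rewrite Rinv_1 (S_INR n); lra.
Qed.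

(** Coefficients dominated by those of [exp]: at a point beyond a finite radius
    the terms of the series could not tend to [0]. *)
Lemma CV_radius_entire (c : nat -> R) :
  (forall n, Rabs (c n) <= / INR (fact n)) -> CV_radius c = p_infty.
Proof.
move=> Hc.
case E : (CV_radius c) => [r| |] //; last first.
  by have := CV_radius_ge_0 c; rewrite E.
exfalso.
have r0 : 0 <= r by have := CV_radius_ge_0 c; rewrite E.
apply: (CV_disk_outside c (r + 1)).
  by rewrite E /= Rabs_pos_eq; lra.
apply/is_lim_seq_abs_0.
have ex : ex_series (fun n => / INR (fact n) * (r + 1) ^ n).
  exists (exp (r + 1)); apply/is_pseries_R; exact: is_exp_Reals.
have := ex_series_lim_0 _ ex.
apply: (is_lim_seq_le_le (fun=> 0) _ _ (Rbar.Finite 0));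
  last exact: is_lim_seq_const.
move=> n; split; first exact: Rabs_pos.
rewrite Rabs_mult -RPow_abs (Rabs_pos_eq (r + 1)); last lra.
apply: Rmult_le_compat_r; [apply: pow_le; lra | exact: Hc].
Qed.

Lemma J_coef_radius : CV_radius J_coef = p_infty.
Proof.
apply: CV_radius_entire => n; have f1 := fact_ge1 n.
rewrite /J_coef Rabs_mult pow_1_abs Rmult_1_l Rabs_pos_eq.
  by apply: Rinv_le_contravar; nra.
by apply/Rlt_le/Rinv_0_lt_compat/pow_lt; lra.
Qed.

Lemma Y_coef_radius : CV_radius Y_coef = p_infty.
Proof.
apply: CV_radius_entire => n; have f1 := fact_ge1 n.
have [h0 h1] := harmonic_bounds n.
have i0 : 0 < / INR (fact n) by apply: Rinv_0_lt_compat; lra.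
have -> : Y_coef n = (-1) ^ n * ((harmonic n * / INR (fact n)) * / INR (fact n)).
  by rewrite /Y_coef; field; lra.
rewrite Rabs_mult pow_1_abs Rmult_1_l Rabs_pos_eq.
  rewrite -[X in _ <= X]Rmult_1_l; apply: Rmult_le_compat_r; first lra.
  rewrite -(Rinv_r (INR (fact n))); last lra.
  by apply: Rmult_le_compat_r; lra.
by apply: Rmult_le_pos; [apply: Rmult_le_pos|]; lra.
Qed.

Lemma is_derive_J_ser (t : R) : is_derive J_ser t (dJ_ser t).
Proof. by apply: is_derive_PSeries; rewrite J_coef_radius. Qed.

Lemma is_derive_Y_ser (t : R) : is_derive Y_ser t (dY_ser t).
Proof. by apply: is_derive_PSeries; rewrite Y_coef_radius. Qed.

Lemma is_derive_mul_PSeries (c : nat -> R) (t : R) :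
  CV_radius c = p_infty ->
  is_derive (fun z => z * PSeries c z) t (PSeries (PS_derive (PS_incr_1 c)) t).
Proof.
move=> Hc; apply: (is_derive_ext (PSeries (PS_incr_1 c))).
  by move=> z; apply: PSeries_incr_1.
by apply: is_derive_PSeries; rewrite CV_radius_incr_1 Hc.
Qed.

(** The Bessel equation, coefficientwise: [(n + 1)^2 a_(n+1) = - a_n]. *)
Lemma is_derive_J_flux (t : R) : is_derive J_flux t (- J_ser t).
Proof.
have := @is_derive_mul_PSeries (PS_derive J_coef) t.
rewrite CV_radius_derive J_coef_radius => /(_ erefl).
have -> // : PSeries (PS_derive (PS_incr_1 (PS_derive J_coef))) t = - J_ser t.
rewrite -PSeries_opp; apply: PSeries_ext => n.
rewrite /PS_derive /PS_incr_1 /PS_opp /J_coef.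
have f1 := fact_ge1 n; have n0 := pos_INR n.
rewrite /Hierarchy.opp INR_factS S_INR -(tech_pow_Rmult (-1)) /=.
field; nra.
Qed.

(** The source term [dJ_ser] comes from the increment [1 / (n + 1)] of the
    harmonic numbers; it is what the logarithm in [Y0] compensates. *)
Lemma is_derive_Y_flux (t : R) : is_derive Y_flux t (dJ_ser t - Y_ser t).
Proof.
have := @is_derive_mul_PSeries (PS_derive Y_coef) t.
rewrite CV_radius_derive Y_coef_radius => /(_ erefl).
have -> // : PSeries (PS_derive (PS_incr_1 (PS_derive Y_coef))) t
           = dJ_ser t - Y_ser t.
rewrite -PSeries_minus; first last.
- by apply: CV_radius_inside; rewrite Y_coef_radius.
- by apply: CV_radius_inside; rewrite CV_radius_derive J_coef_radius.
apply: PSeries_ext => n.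
rewrite /PS_derive /PS_incr_1 /PS_minus /PS_plus /PS_opp /J_coef /Y_coef harmonicS.
have f1 := fact_ge1 n; have n0 := pos_INR n.
rewrite /Hierarchy.opp /Hierarchy.plus INR_factS S_INR -(tech_pow_Rmult (-1)) /=.
field; nra.
Qed.

(** Abel's identity: the left-hand side has derivative zero on the whole line,
    so it equals its value at [0].  It is the Wronskian of [J0] and [Y0] after
    the logarithms have cancelled. *)
Lemma ser_wronskian (t : R) :
  J_ser t ^ 2 + 2 * (J_flux t * Y_ser t - J_ser t * Y_flux t) = 1.
Proof.
set H := fun t => J_ser t ^ 2 + 2 * (J_flux t * Y_ser t - J_ser t * Y_flux t).
have dH s : is_derive H s 0.
  have [d1 E1] := is_derive_ex_eq (is_derive_J_ser s).
  have [d2 E2] := is_derive_ex_eq (is_derive_Y_ser s).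
  have [d3 E3] := is_derive_ex_eq (is_derive_J_flux s).
  have [d4 E4] := is_derive_ex_eq (is_derive_Y_flux s).
  rewrite /H; auto_derive; first by repeat split.
  rewrite E1 E2 E3 E4 /J_flux /Y_flux; ring.
have H0 : H 0 = 1.
  by rewrite /H /J_flux /Y_flux /J_ser PSeries_0 /J_coef /=; field.
rewrite -/(H t) -H0.
have [[t0|->]|t0] := total_order_T t 0; [|by []|].
- by apply: (eq_is_derive H t 0) => // s _; apply: dH.
- by symmetry; apply: (eq_is_derive H 0 t) => // s _; apply: dH.
Qed.

(** Energy argument: by [(t f')' = - f], the quantity [f^2 + t f'^2] has
    derivative [- f'^2], and it equals [1] at [0]. *)
Lemma J_ser_le1 (t : R) : 0 <= t -> J_ser t <= 1.
Proof.
move=> t0.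
set E := fun s => J_ser s ^ 2 + J_flux s * dJ_ser s.
have exJ' s : ex_derive (fun z => dJ_ser z) s.
  by apply: ex_derive_PSeries; rewrite CV_radius_derive J_coef_radius.
have ode s : dJ_ser s + s * Derive (fun z => dJ_ser z) s = - J_ser s.
  have [d1 <-] := is_derive_ex_eq (is_derive_J_flux s).
  change (Derive (fun z => dJ_ser z) s) with (Derive dJ_ser s).
  rewrite /J_flux Derive_mult ?Derive_id;
    [ring | exact: ex_derive_id | exact: exJ'].
have E0 : E 0 = 1 by rewrite /E /J_flux /J_ser PSeries_0 /J_coef /=; field.
have : - E 0 <= - E t.
  apply: (@nondecreasing_of_derive (fun s => - E s) (fun s => dJ_ser s ^ 2)) => //.
    move=> s _.
    have [d1 E1] := is_derive_ex_eq (is_derive_J_ser s).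
    have [d3 E3] := is_derive_ex_eq (is_derive_J_flux s).
    rewrite /E; auto_derive; first by repeat split.
    rewrite E1 E3 /J_flux.
    have := ode s; move: (Derive _ _) => J''; nra.
  by move=> s _; exact: pow2_ge_0.
rewrite E0 /E /J_flux.
have := Rmult_le_pos _ _ t0 (pow2_ge_0 (dJ_ser t)); nra.
Qed.

(** From [f <= 1], integrating [(t f')' = - f] twice gives the lower bound, and
    feeding that bound into the same equation gives the upper one. *)
Lemma J_ser_bounds (t : R) : 0 <= t -> 1 - t <= J_ser t <= 1 - t + t ^ 2 / 4.
Proof.
have ser0 : J_ser 0 = 1 by rewrite /J_ser PSeries_0 /J_coef /=; field.
have flux0 : J_flux 0 = 0 by rewrite /J_flux; ring.
have lower s : 0 <= s -> 1 - s <= J_ser s.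
  move=> s0.
  have := @nondecreasing_of_derive
    (fun s => J_ser s + s) (fun s => dJ_ser s + 1) 0 s s0.
  rewrite ser0 => H; suff : 1 + 0 <= J_ser s + s by lra.
  apply: H => c c0.
    have [d1 E1] := is_derive_ex_eq (is_derive_J_ser c).
    by auto_derive; [|rewrite E1; ring].
  have := @nondecreasing_of_derive
    (fun s => J_flux s + s) (fun s => - J_ser s + 1) 0 c ltac:(lra).
  rewrite flux0 => H; suff : 0 + 0 <= J_flux c + c by rewrite /J_flux; nra.
  apply: H => d d0.
    have [d1 E1] := is_derive_ex_eq (is_derive_J_flux d).
    by auto_derive; [|rewrite E1; ring].
  by have := @J_ser_le1 d ltac:(lra); lra.
move=> t0; split; first exact: lower.
have := @nondecreasing_of_derive
  (fun s => 1 - s + s ^ 2 / 4 - J_ser s)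
  (fun s => - 1 + s / 2 - dJ_ser s) 0 t t0.
rewrite ser0 => H; suff : 1 - 0 + 0 ^ 2 / 4 - 1 <= 1 - t + t ^ 2 / 4 - J_ser t by lra.
apply: H => c c0.
  have [d1 E1] := is_derive_ex_eq (is_derive_J_ser c).
  by auto_derive; [|rewrite E1; field].
have := @nondecreasing_of_derive
  (fun s => s ^ 2 / 2 - s - J_flux s) (fun s => s - 1 + J_ser s) 0 c ltac:(lra).
rewrite flux0 => H; suff : 0 ^ 2 / 2 - 0 - 0 <= c ^ 2 / 2 - c - J_flux c.
  rewrite /J_flux; nra.
apply: H => d d0.
  have [d1 E1] := is_derive_ex_eq (is_derive_J_flux d).
  by auto_derive; [|rewrite E1; field].
by have := lower d ltac:(lra); lra.
Qed.

(** * The Bessel equation and the Wronskian *)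

Lemma J0_ser (s : R) : J0 s = J_ser ((s / 2) ^ 2).
Proof. by []. Qed.

Lemma Y0_ser (s : R) :
  Y0 s = 2 / PI * ((ln (s / 2) + euler_gamma) * J_ser ((s / 2) ^ 2)
                   - Y_ser ((s / 2) ^ 2)).
Proof. by []. Qed.

(** [J0_flux s] is [s J0'(s)], because [s d/ds = 2 t d/dt]. *)
Definition J0_flux (s : R) : R := 2 * J_flux ((s / 2) ^ 2).

(** [Y0_flux s] is [s Y0'(s)]; the lone [J0 s] comes from differentiating
    the logarithm. *)
Definition Y0_flux (s : R) : R :=
  2 / PI * ((ln (s / 2) + euler_gamma) * J0_flux s + J0 s
            - 2 * Y_flux ((s / 2) ^ 2)).

Lemma is_derive_comp_half_sq (f : R -> R) (s l : R) :
  is_derive f ((s / 2) ^ 2) l -> is_derive (fun z => f ((z / 2) ^ 2)) s (s / 2 * l).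
Proof.
move=> Hf; apply: (is_derive_comp f (fun z => (z / 2) ^ 2)) => //.
by auto_derive => //; field.
Qed.

Lemma is_derive_J0 (s : R) : 0 < s -> is_derive J0 s (J0_flux s / s).
Proof.
move=> s0.
have -> : J0_flux s / s = s / 2 * dJ_ser ((s / 2) ^ 2).
  by rewrite /J0_flux /J_flux; field; lra.
by apply: is_derive_comp_half_sq; apply: is_derive_J_ser.
Qed.

Lemma is_derive_J0_flux (s : R) : 0 < s -> is_derive J0_flux s (- (s * J0 s)).
Proof.
move=> s0.
have [d1 E1] := is_derive_ex_eq
  (is_derive_comp_half_sq (is_derive_J_flux ((s / 2) ^ 2))).
rewrite /J0_flux; set P := fun z => J_flux ((z / 2) ^ 2) in d1 E1 *.
apply: (is_derive_ext (fun z => 2 * P z)) => //.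
by auto_derive => //; rewrite E1 J0_ser; field.
Qed.

Lemma is_derive_Y0 (s : R) : 0 < s -> is_derive Y0 s (Y0_flux s / s).
Proof.
move=> s0; have PI0 := PI_RGT_0.
have [d1 E1] := is_derive_ex_eq (is_derive_J0 s0).
have [d2 E2] := is_derive_ex_eq
  (is_derive_comp_half_sq (is_derive_Y_ser ((s / 2) ^ 2))).
set P := fun z => Y_ser ((z / 2) ^ 2) in d2 E2 *.
apply: (is_derive_ext
  (fun z => 2 / PI * ((ln (z / 2) + euler_gamma) * J0 z - P z))) => //.
auto_derive; first by repeat split => //; lra.
rewrite E1 E2 /Y0_flux /Y_flux /J0_flux -!/(Rdiv _ _).
by field; lra.
Qed.

Lemma is_derive_Y0_flux (s : R) : 0 < s -> is_derive Y0_flux s (- (s * Y0 s)).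
Proof.
move=> s0; have PI0 := PI_RGT_0.
have [d1 E1] := is_derive_ex_eq (is_derive_J0 s0).
have [d2 E2] := is_derive_ex_eq (is_derive_J0_flux s0).
have [d3 E3] := is_derive_ex_eq
  (is_derive_comp_half_sq (is_derive_Y_flux ((s / 2) ^ 2))).
set P := fun z => Y_flux ((z / 2) ^ 2) in d3 E3 *.
apply: (is_derive_ext (fun z => 2 / PI *
  ((ln (z / 2) + euler_gamma) * J0_flux z + J0 z - 2 * P z))) => //.
auto_derive; first by repeat split => //; lra.
rewrite E1 E2 E3 Y0_ser -J0_ser /J0_flux /J_flux -!/(Rdiv _ _).
by field; lra.
Qed.

Lemma bessel_wronskian (s : R) :
  J0 s * Y0_flux s - Y0 s * J0_flux s = 2 / PI.
Proof.
have PI0 := PI_RGT_0.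
rewrite -[RHS]Rmult_1_r -(ser_wronskian ((s / 2) ^ 2)).
rewrite /Y0_flux Y0_ser /J0_flux J0_ser.
by field; lra.
Qed.

Lemma J0_bounds (s : R) : 1 - s ^ 2 / 4 <= J0 s <= 1 - s ^ 2 / 4 + s ^ 4 / 64.
Proof.
have := J_ser_bounds (pow2_ge_0 (s / 2)); rewrite -J0_ser.
have -> : ((s / 2) ^ 2) ^ 2 / 4 = s ^ 4 / 64 by field.
by have -> : (s / 2) ^ 2 = s ^ 2 / 4 by field.
Qed.

Lemma J0_gt0 (s : R) : 0 < s < 2 -> 0 < J0 s.
Proof. by move=> s0; have [lo _] := J0_bounds s; nra. Qed.

(** With [t = s^2 / 4] one has [J0 <= (1 - t / 2)^2], and
    [(1 + t) (1 - t / 2)^2 <= 1] on [[0, 1]], while [1 + 2 t <= (1 + t)^2]. *)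
Lemma J0_sq_bound (s : R) : 0 < s < 2 -> (1 + s ^ 2 / 2) * J0 s ^ 2 <= 1.
Proof.
move=> s0; have J0s := J0_gt0 s0; have [_] := J0_bounds s.
set t := s ^ 2 / 4.
have t0 : 0 <= t <= 1 by rewrite /t; nra.
have -> : s ^ 4 / 64 = t ^ 2 / 4 by rewrite /t; field.
have -> : 1 + s ^ 2 / 2 = 1 + 2 * t by rewrite /t; field.
move=> up.
have b : (1 + t) * J0 s <= 1.
  apply: Rle_trans (_ : (1 + t) * (1 - t + t ^ 2 / 4) <= 1); last nra.
  by apply: Rmult_le_compat_l; lra.
have b0 : 0 <= (1 + t) * J0 s by apply: Rmult_le_pos; lra.
have b2 : ((1 + t) * J0 s) ^ 2 <= 1 by nra.
have := pow2_ge_0 (t * J0 s); lra.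
Qed.

(** * Lower bounds for the cross product *)

(** The function [u' sin (x - s) + u cos (x - s)] of [s] would be constant for
    the unperturbed oscillator [u'' = - u]; it runs from [u'(y) sin (x - y)] to
    [u x].  For the perturbed equation its derivative is
    [- u sin (x - s) / (4 s^2)].  The sine is nonnegative because
    [x - y <= PI], and [u] is at most [u'(y)] because the energy
    [u'^2 + (1 + 1 / (4 s^2)) u^2] decreases. *)
Lemma bessel_oscillation (u v : R -> R) (x y : R) :
  0 < y <= x ->
  (forall s, 0 < s -> is_derive u s (v s)) ->
  (forall s, 0 < s -> is_derive v s (- ((1 + / (4 * s ^ 2)) * u s))) ->
  u y = 0 -> 0 <= v y -> x - y <= PI ->
  v y * (sin (x - y) - (x - y) / (4 * y ^ 2)) <= u x.
Proof.
move=> [y0 yx] Hu Hv uy vy xyPI.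
have bound s : y <= s -> u s <= v y.
  move=> ys.
  have E : - (v y ^ 2 + (1 + / (4 * y ^ 2)) * u y ^ 2)
        <= - (v s ^ 2 + (1 + / (4 * s ^ 2)) * u s ^ 2).
    apply: (@nondecreasing_of_derive
      (fun s => - (v s ^ 2 + (1 + / (4 * s ^ 2)) * u s ^ 2))
      (fun s => / (2 * s ^ 3) * u s ^ 2) y s ys) => c [yc cs];
      have c0 : 0 < c by lra.
      have [du Eu] := is_derive_ex_eq (Hu c c0).
      have [dv Ev] := is_derive_ex_eq (Hv c c0).
      auto_derive; first by repeat split=> //; nra.
      rewrite Eu Ev; field; lra.
    apply: Rmult_le_pos; last exact: pow2_ge_0.
    by apply/Rlt_le/Rinv_0_lt_compat; have := pow_lt c 3 c0; lra.
  rewrite uy in E.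
  have s2 : 0 < / (4 * s ^ 2).
    by apply: Rinv_0_lt_compat; have := pow_lt s 2 ltac:(lra); lra.
  have := pow2_ge_0 (v s); have := pow2_ge_0 (u s) => us2 vs2.
  have us2' := Rmult_le_pos _ _ (Rlt_le _ _ s2) us2.
  have uv : u s ^ 2 <= v y ^ 2 by lra.
  nra.
set K := v y / (4 * y ^ 2).
have K0 : 0 <= K.
  by apply: Rdiv_le_0_compat => //; have := pow_lt y 2 y0; lra.
have E : v y * sin (x - y) + u y * cos (x - y) + K * y
      <= v x * sin (x - x) + u x * cos (x - x) + K * x.
  apply: (@nondecreasing_of_derive
    (fun s => v s * sin (x - s) + u s * cos (x - s) + K * s)
    (fun s => K - / (4 * s ^ 2) * (u s * sin (x - s))) y x yx) => c [yc cx];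
    have c0 : 0 < c by lra.
    have [du Eu] := is_derive_ex_eq (Hu c c0).
    have [dv Ev] := is_derive_ex_eq (Hv c c0).
    auto_derive; first by repeat split=> //.
    rewrite Eu Ev -/(Rminus x c); field; lra.
  have sin0 : 0 <= sin (x - c) by apply: sin_ge_0; lra.
  have [_ sin1] := SIN_bound (x - c).
  have uv := bound c (Rlt_le _ _ yc).
  have q0 : 0 < / (4 * c ^ 2).
    by apply: Rinv_0_lt_compat; have := pow_lt c 2 c0; lra.
  have q1 : / (4 * c ^ 2) <= / (4 * y ^ 2).
    by apply: Rinv_le_contravar; have := pow_lt y 2 y0; [lra | nra].
  have usv : u c * sin (x - c) <= v y by nra.
  rewrite /K /Rdiv; nra.
rewrite Rminus_diag sin_0 cos_0 uy in E.
rewrite /K in E.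
have -> : v y * (sin (x - y) - (x - y) / (4 * y ^ 2))
  = v y * sin (x - y) - v y / (4 * y ^ 2) * (x - y) by field; lra.
lra.
Qed.

(** Here [G] stands for [s F'].  The Liouville substitution [u = sqrt s * F]
    removes the first-order term of the Bessel equation. *)
Lemma bessel_liouville (F G : R -> R) (x y : R) :
  0 < y <= x ->
  (forall s, 0 < s -> is_derive F s (G s / s)) ->
  (forall s, 0 < s -> is_derive G s (- (s * F s))) ->
  F y = 0 -> 0 <= G y -> x - y <= PI ->
  G y * (sin (x - y) - (x - y) / (4 * y ^ 2)) <= sqrt (x * y) * F x.
Proof.
move=> [y0 yx] HF HG Fy Gy xyPI.
have sy := sqrt_lt_R0 y y0.
have := @bessel_oscillation (fun s => sqrt s * F s)
  (fun s => (F s / 2 + G s) / sqrt s) x y (conj y0 yx) _ _ _ _ xyPI.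
rewrite Fy sqrt_mult; try lra.
have -> : (0 / 2 + G y) / sqrt y = G y / sqrt y by field; lra.
move=> H.
apply: (Rmult_le_reg_l (/ sqrt y)); first exact: Rinv_0_lt_compat.
have -> : / sqrt y * (sqrt x * sqrt y * F x) = sqrt x * F x by field; lra.
apply: Rle_trans (H _ _ _ _).
- by apply: Req_le; field; lra.
- move=> s s0; have ss := sqrt_lt_R0 s s0.
  have [dF EF] := is_derive_ex_eq (HF s s0).
  auto_derive; first by repeat split.
  rewrite EF.
  (* Everything has to be expressed through [sqrt s] for [field]. *)
  set r := sqrt s in ss *.
  have -> : s = r * r by rewrite /r sqrt_sqrt; lra.
  field; lra.
- move=> s s0; have ss := sqrt_lt_R0 s s0.
  have [dF EF] := is_derive_ex_eq (HF s s0).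
  have [dG EG] := is_derive_ex_eq (HG s s0).
  auto_derive; first by repeat split => //; lra.
  rewrite EF EG.
  (* Everything has to be expressed through [sqrt s] for [field]. *)
  set r := sqrt s in ss *.
  have -> : s = r * r by rewrite /r sqrt_sqrt; lra.
  field; lra.
- by lra.
- by apply: Rdiv_le_0_compat.
Qed.

Definition cross (x y : R) : R := J0 x * Y0 y - J0 y * Y0 x.

(** As a function of [x], [- cross x y] vanishes at [y] and has flux [2 / PI]
    there by the Wronskian.  The factor [sqrt (x y)] is at most [x]. *)
Lemma cross_lower_far (x y : R) :
  0 < y <= x -> x - y <= PI ->
  2 / PI * (sin (x - y) - (x - y) / (4 * y ^ 2)) <= x * Rabs (cross x y).
Proof.
move=> [y0 yx] xyPI; have PI0 := PI_RGT_0.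
have := @bessel_liouville (fun s => J0 y * Y0 s - J0 s * Y0 y)
  (fun s => J0 y * Y0_flux s - J0_flux s * Y0 y) x y (conj y0 yx).
have -> : J0 y * Y0_flux y - J0_flux y * Y0 y = 2 / PI.
  by rewrite -(bessel_wronskian y); ring.
move=> H; apply: Rle_trans (H _ _ _ _ xyPI) _.
- move=> s s0.
  have [d1 E1] := is_derive_ex_eq (is_derive_J0 s0).
  have [d2 E2] := is_derive_ex_eq (is_derive_Y0 s0).
  by auto_derive; [repeat split | rewrite E1 E2; field; lra].
- move=> s s0.
  have [d1 E1] := is_derive_ex_eq (is_derive_J0_flux s0).
  have [d2 E2] := is_derive_ex_eq (is_derive_Y0_flux s0).
  by auto_derive; [repeat split | rewrite E1 E2; ring].
- ring.
- by apply: Rdiv_le_0_compat; lra.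
have -> : J0 y * Y0 x - J0 x * Y0 y = - cross x y by rewrite /cross; ring.
have sq : sqrt (x * y) <= x.
  rewrite -[X in _ <= X]sqrt_square; last lra.
  by apply: sqrt_le_1_alt; nra.
have := sqrt_pos (x * y); have := Rle_abs (- cross x y); rewrite Rabs_Ropp.
have := Rabs_pos (cross x y); nra.
Qed.

(** The function [Y0 / J0] has derivative [(2 / PI) / (s J0^2)] by the Wronskian,
    hence at least [(2 / PI) (1 / s + s / 2)] by [J0_sq_bound], which is the
    derivative of [(2 / PI) (ln s + s^2 / 4)]. *)
Lemma cross_lower_near (x y : R) : 0 < x <= y -> y < 2 ->
  2 / PI * (J0 x * J0 y) * (ln (y / x) + (y ^ 2 - x ^ 2) / 4) <= cross x y.
Proof.
move=> [x0 xy] y2; have PI0 := PI_RGT_0.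
have Jx := @J0_gt0 x ltac:(lra); have Jy := @J0_gt0 y ltac:(lra).
have : Y0 x / J0 x - 2 / PI * (ln x + x ^ 2 / 4)
    <= Y0 y / J0 y - 2 / PI * (ln y + y ^ 2 / 4).
  apply: (@nondecreasing_of_derive
    (fun s => Y0 s / J0 s - 2 / PI * (ln s + s ^ 2 / 4))
    (fun s => 2 / PI / s * (/ J0 s ^ 2 - (1 + s ^ 2 / 2))) x y xy)
    => s [xs sy]; have s0 : 0 < s by lra.
    have Js := @J0_gt0 s ltac:(lra).
    have [d1 E1] := is_derive_ex_eq (is_derive_J0 s0).
    have [d2 E2] := is_derive_ex_eq (is_derive_Y0 s0).
    auto_derive; first by repeat split => //; lra.
    have -> : 2 / PI / s * (/ J0 s ^ 2 - (1 + s ^ 2 / 2))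
      = (J0 s * Y0_flux s - Y0 s * J0_flux s) / s / J0 s ^ 2
        - 2 / PI / s * (1 + s ^ 2 / 2).
      by rewrite bessel_wronskian; field; lra.
    by rewrite E1 E2; field; lra.
  have Js := @J0_gt0 s ltac:(lra).
  apply: Rmult_le_pos.
    by apply: Rdiv_le_0_compat => //; apply: Rdiv_le_0_compat; lra.
  have := @J0_sq_bound s ltac:(lra) => b.
  have J2 : 0 < J0 s ^ 2 by apply: pow_lt.
  have := Rmult_le_compat_l _ _ _ (Rlt_le _ _ (Rinv_0_lt_compat _ J2)) b.
  have -> : / J0 s ^ 2 * ((1 + s ^ 2 / 2) * J0 s ^ 2) = 1 + s ^ 2 / 2.
    by field; lra.
  lra.
move=> H.
have -> : cross x y = J0 x * J0 y * (Y0 y / J0 y - Y0 x / J0 x).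
  by rewrite /cross; field; lra.
rewrite Rcomplements.ln_div; try lra.
have JJ := Rmult_lt_0_compat _ _ Jx Jy.
have := Rmult_le_compat_l _ _ _ (Rlt_le _ _ JJ) H.
lra.
Qed.

(** * Reduction of the determinants to the cross product *)

Lemma det_matA (k r1 r2 : R) : \det (matA k r1 r2) = cross (k * r1) (k * r2).
Proof.
rewrite /matA (expand_det_row _ ord0) !big_ord_recl big_ord0.
rewrite /cofactor !det_mx11 !mxE /=.
rewrite -?(RplusE, RmultE, RoppE, RpowE, R0E, R1E) /= /cross.
ring.
Qed.

(** The rows of [matD] express the products of the two rows of [matA], seen as
    linear forms, in the squares and the product of the variables.  So [matD]
    is the symmetric square of [matA]; with eigenvalues [p] and [q] of [matA],
    its eigenvalues are [p^2], [q^2] and [p q]. *)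
Lemma det_matD (k r1 r2 : R) : \det (matD k r1 r2) = (\det (matA k r1 r2)) ^ 3.
Proof.
rewrite det_matA /matD.
rewrite (expand_det_row _ ord0) !big_ord_recl big_ord0 /cofactor.
rewrite !(expand_det_row _ ord0) !big_ord_recl !big_ord0 /cofactor.
rewrite !det_mx11 !mxE /=.
rewrite -?(RplusE, RmultE, RoppE, RpowE, R0E, R1E) /= /cross.
ring.
Qed.

(** * The geometry of the sources *)

(** Law of cosines: the distance from a point of the unit circle to a source at
    radius [lam], where [c] is the cosine of the angle between them. *)
Definition reach (lam c : R) : R := sqrt (1 + lam ^ 2 - 2 * lam * c).

Lemma dist2_source (m : nat) (rho lam theta : R) (j : nat) : 0 <= rho ->
  dist2 (polar rho theta) (source m rho lam j)
  = rho * reach lam (cos (theta - nu m (2 * INR j - 1))).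
Proof.
move=> rho0; rewrite /dist2 /source /polar /dist_euc /reach /=.
set al := nu m _.
rewrite -[X in _ = X * _](sqrt_square rho) // -sqrt_mult_alt; last nra.
congr sqrt; rewrite cos_minus /Rsqr.
have Et := sin2_cos2 theta; have Ea := sin2_cos2 al.
rewrite /Rsqr in Et Ea; nra.
Qed.

(** Seen from the centre, a point of an arc is within the angle
    [PI / m <= PI / 10 <= 0.315] of the ray that carries the sources, and
    [1 - 0.315^2 / 2 >= 0.95]. *)
Lemma arc_cos_ge (m : nat) (theta : R) (j : nat) : (10 <= m)%N ->
  nu m (2 * INR j - 2) <= theta <= nu m (2 * INR j) ->
  95 / 100 <= cos (theta - nu m (2 * INR j - 1)) <= 1.
Proof.
move=> hm; rewrite /nu => [[lo up]]; have [pi1 pi2] := pi_bounds.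
have m10 : 10 <= INR m.
  have -> : 10 = INR 10 by rewrite /=; ring.
  by apply: le_INR; apply/leP.
set d := theta - _.
have dm : - (PI / INR m) <= d <= PI / INR m.
  have E s : s * PI / INR m = s * (PI / INR m) by field; lra.
  by rewrite /d; move: lo up; rewrite !E; lra.
have pm : PI / INR m <= 315 / 1000.
  by apply: (proj2 (Rle_div_l _ _ (INR m) ltac:(lra))); lra.
split; last by have := COS_bound d; lra.
apply: Rle_trans (@cos_ge_quadratic d ltac:(lra)); nra.
Qed.

(** Put [X = reach (1/2) c] and [Y = reach (1/2 + e) c].  The triangle
    inequality gives [X - Y <= e], and [X^2 - Y^2 = e (2 c - 1 - e)] with
    [X + Y <= 1.096] gives [X - Y >= 0.74 e].  As [K e = PI / 2], the sine in
    [cross_lower_far] is taken close to its maximum. *)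
Lemma cross_far_sources (K e c : R) :
  6 * PI <= K -> e = PI / (2 * K) -> 95 / 100 <= c <= 1 ->
  1 / K <= Rabs (cross (K * reach (1 / 2) c) (K * reach (1 / 2 + e) c)).
Proof.
move=> HK He [c1 c2]; have [pi1 pi2] := pi_bounds.
have Ke : K * e = PI / 2 by rewrite He; field; lra.
have e0 : 0 < e by rewrite He; apply: Rdiv_lt_0_compat; lra.
have e1 : e <= 1 / 12 by nra.
set X := reach (1 / 2) c.
set Y := reach (1 / 2 + e) c.
have Xge0 : 0 <= X by apply: sqrt_pos.
have Yge0 : 0 <= Y by apply: sqrt_pos.
have X2 : X * X = 5 / 4 - c by rewrite /X /reach sqrt_sqrt; lra.
have Y2 : Y * Y = X * X - e * (2 * c - 1 - e).
  rewrite X2 /Y /reach sqrt_sqrt; first by field.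
  nra.
have Xlo : 1 / 2 <= X by nra.
have Xup : X <= 548 / 1000 by nra.
have YX : Y <= X by nra.
have Ylo : X - e <= Y.
  have : (X - e) * (X - e) <= Y * Y by nra.
  nra.
(* [0.815] is a lower bound of [2 * 0.95 - 1 - 1 / 12]. *)
have gap : 74 / 100 * e <= X - Y.
  have E : (X - Y) * (X + Y) = e * (2 * c - 1 - e) by lra.
  have lo : e * (815 / 1000) <= e * (2 * c - 1 - e).
    by apply: Rmult_le_compat_l; lra.
  have := Rmult_le_compat_l (X - Y) (X + Y) (1096 / 1000) ltac:(lra) ltac:(lra).
  lra.
have y0 : 0 < K * Y by apply: Rmult_lt_0_compat; lra.
have K0 : 0 < K by lra.
have yx : K * Y <= K * X by apply: Rmult_le_compat_l; lra.
have xy1 : K * X - K * Y <= PI / 2.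
  have := Rmult_le_compat_l K _ _ ltac:(lra) Ylo; lra.
have xy2 : 74 / 100 * (PI / 2) <= K * X - K * Y.
  have := Rmult_le_compat_l K _ _ ltac:(lra) gap; lra.
have := @cross_lower_far (K * X) (K * Y) (conj y0 yx) ltac:(lra).
(* The sine is the cosine of an angle of at most [0.26 * PI / 2 <= 0.41]. *)
have sin_lo : 916 / 1000 <= sin (K * X - K * Y).
  rewrite -cos_shift.
  have := @cos_ge_quadratic (PI / 2 - (K * X - K * Y)) ltac:(lra).
  nra.
have y7 : 775 / 100 <= K * Y by nra.
have err : (K * X - K * Y) / (4 * (K * Y) ^ 2) <= 7 / 1000.
  apply/Rle_div_l; nra.
set C := Rabs _; have C0 : 0 <= C by apply: Rabs_pos.
have p : 634 / 1000 <= 2 / PI by apply: (proj1 (Rle_div_r _ 2 PI ltac:(lra))); lra.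
move=> H; apply/Rle_div_l; first lra.
have : 634 / 1000 * (909 / 1000) <= K * X * C.
  by apply: Rle_trans H; apply: Rmult_le_compat; lra.
have := Rmult_le_compat_r C _ _ C0 Xup.
nra.
Qed.

(** The ratio of the two distances has square at least [20], which is where
    [ln (Y / X) >= 1.4] comes from. *)
Lemma cross_near_sources (c : R) : 95 / 100 <= c <= 1 ->
  4 / 9 <= cross (PI / 5 * reach (1 / 2) c) (PI / 5 * reach (- (3 / 2)) c).
Proof.
move=> [c1 c2]; have [pi1 pi2] := pi_bounds.
set X := reach (1 / 2) c.
set Y := reach (- (3 / 2)) c.
have Xge0 : 0 <= X by apply: sqrt_pos.
have Yge0 : 0 <= Y by apply: sqrt_pos.
have X2 : X * X = 5 / 4 - c by rewrite /X /reach sqrt_sqrt; lra.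
have Y2 : Y * Y = 13 / 4 + 3 * c by rewrite /Y /reach sqrt_sqrt; lra.
have Xlo : 1 / 2 <= X by nra.
have Yup : Y <= 5 / 2 by nra.
have XY : X <= Y by nra.
have ratio : 14 / 10 <= ln (Y / X).
  (* [(Y / X)^2 >= 20 >= (10 / 9)^28], and [ln (10 / 9) >= 1 / 10]. *)
  have ln9 : ln (9 / 10) <= - (1 / 10).
    rewrite -(ln_exp (- (1 / 10))); apply: ln_le; first lra.
    by have := exp_ineq1_le (- (1 / 10)); lra.
  have ln10 : 1 / 10 <= ln (10 / 9).
    have -> : 10 / 9 = / (9 / 10) by field.
    by rewrite ln_Rinv; lra.
  apply: (Rle_trans _ (ln ((10 / 9) ^ 14))).
    by rewrite ln_pow; [rewrite /=; lra | lra].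
  apply: ln_le; first by apply: pow_lt; lra.
  apply: (proj1 (Rle_div_r _ Y X ltac:(lra))).
  nra.
set x := PI / 5 * X; set y := PI / 5 * Y.
have x2 : x ^ 2 / 4 <= 3 / 100.
  have -> : x ^ 2 / 4 = PI * PI * (X * X) / 100 by rewrite /x; field.
  rewrite X2; nra.
have y2 : y ^ 2 / 4 <= 621 / 1000.
  have -> : y ^ 2 / 4 = PI * PI * (Y * Y) / 100 by rewrite /y; field.
  rewrite Y2; nra.
have gap : 55 / 100 <= (y ^ 2 - x ^ 2) / 4.
  have -> : (y ^ 2 - x ^ 2) / 4 = PI * PI * (Y * Y - X * X) / 100.
    by rewrite /x /y; field.
  rewrite X2 Y2; nra.
have x0 : 0 < x by apply: Rmult_lt_0_compat; lra.
have xy : x <= y by apply: Rmult_le_compat_l; lra.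
have y_2 : y < 2 by nra.
apply: Rle_trans (cross_lower_near (conj x0 xy) y_2).
have [Jx _] := J0_bounds x; have [Jy _] := J0_bounds y.
have -> : y / x = Y / X by rewrite /x /y; field; lra.
have JJ : 97 / 100 * (379 / 1000) <= J0 x * J0 y by apply: Rmult_le_compat; lra.
have p : 634 / 1000 <= 2 / PI.
  by apply: (proj1 (Rle_div_r _ 2 PI ltac:(lra))); lra.
have pJJ : 634 / 1000 * (97 / 100 * (379 / 1000)) <= 2 / PI * (J0 x * J0 y).
  by apply: Rmult_le_compat; lra.
have := Rmult_le_compat _ _ _ _ _ _ pJJ
  (Rplus_le_compat _ _ _ _ ratio gap).
by move=> /(_ ltac:(lra) ltac:(lra)); lra.
Qed.

(** * Lower bounds for the determinants *)

Lemma M_bounds (tau : R) : 6 <= tau -> 0 <= M tau <= 1.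
Proof.
move=> htau; rewrite /M; split; first by apply: Rdiv_le_0_compat; lra.
by apply: (proj2 (Rle_div_l _ _ (20 * tau) ltac:(lra))); lra.
Qed.

Theorem theorem2p1 (a : R) (ha : 0 < a) (m : nat) (hm : (10 <= m)%N)
    (tau : R) (htau : 6 <= tau) (k : R) (hk : admissible a k)
    (j : nat) (hj : (1 <= j <= m)%N)
    (x : R * R) (hx : arc m (radius a tau k) j x) :
  Rabs (\det (A_at a tau m k j x)) >=
    (if Req_dec_T k (kstar a) then Mstar else M tau / (k * radius a tau k)) /\
  Rabs (\det (D_at a tau m k j x)) >=
    (if Req_dec_T k (kstar a) then Mstar ^ 3
     else (M tau / (k * radius a tau k)) ^ 3).
Proof.
have pi0 := PI_RGT_0.
set b := if Req_dec_T k (kstar a) then Mstar else M tau / (k * radius a tau k).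
have -> : (if Req_dec_T k (kstar a) then Mstar ^ 3
           else (M tau / (k * radius a tau k)) ^ 3) = b ^ 3.
  by rewrite /b; case: Req_dec_T.
suff [b0 bA] : 0 <= b /\ b <= Rabs (\det (A_at a tau m k j x)).
  split; first exact: Rle_ge.
  rewrite /D_at det_matD -RPow_abs; apply: Rle_ge.
  exact: pow_incr (conj b0 bA).
case: hx => theta [htheta ->].
have hc := @arc_cos_ge _ _ _ hm htheta; set c := cos _ in hc.
have radius0 : 0 <= radius a tau k.
  by rewrite /radius; case: Req_dec_T => ? /=; nra.
rewrite /A_at det_matA !dist2_source // -/c -!Rmult_assoc /b /lambda1 /lambda2.
move: radius0; rewrite /radius; case: Req_dec_T => [hks | hks] _ /=.
- have -> : k * (6 * a) = PI / 5 by rewrite hks /kstar; field; lra.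
  rewrite /Mstar; split; first lra.
  by apply: Rle_trans (Rle_abs _); apply: cross_near_sources.
- case: hk => // -[t [t1 kt]].
  have -> : 2 * k * (tau * a) = 2 * (k * (tau * a)) by ring.
  have EK : k * (tau * a) = PI * (t * tau) by rewrite kt; field; lra.
  set K := k * (tau * a) in EK *.
  have ttau : 6 <= t * tau by nra.
  have HK : 6 * PI <= K by rewrite EK; nra.
  have [M0 M1] := @M_bounds _ htau.
  split; first by apply: Rdiv_le_0_compat; lra.
  apply: Rle_trans (@cross_far_sources _ _ _ HK erefl hc).
  apply: Rmult_le_compat_r => //.
  by apply/Rlt_le/Rinv_0_lt_compat; lra.
Qed.
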